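(* Let $K$ be a field of characteristic different from two, let $D$ be a (finite-dimensional) central division algebra over $K$ (that is, with center $K$) equipped with an involution $\bar{\phantom{x}}$, let $n,k\geq 1$ be integers and let $\varepsilon\in\{1,-1\}$. Let $D^{k\times n}$ be the set of $k\times n$ matrices over $D$, regarded as a right $M_n(D)$-module via matrix multiplication, and let $$h:D^{k\times n}\times D^{k\times n}\to M_n(D)$$ be an $\varepsilon$-hermitian form over $(M_n(D),\bar{\phantom{x}}^t)$. Then there exists an $\varepsilon$-hermitian $k\times k$ matrix $B\in M_k(D)$ (that is, $\bar{B}^t=\varepsilon B$) such that $$h(x,y)=\bar{x}^tBy\quad\text{for all } x,y\in D^{k\times n}.$$
   Context: An involution on a ring is an additive anti-automorphism of order at most two; the involution on $D$ is not assumed to be trivial on $K$. For a (possibly rectangular) matrix $x=(x_{ij})$ over $D$, $\bar{x}^t$ denotes the conjugate transpose, whose $(i,j)$ entry is $\overline{x_{ji}}$; the map $X\mapsto\bar{X}^t$ is an involution on $M_n(D)$, denoted $\bar{\phantom{x}}^t$. An $\varepsilon$-hermitian form over $(M_n(D),\bar{\phantom{x}}^t)$ on a right $M_n(D)$-module $M$ is a biadditive map $h:M\times M\to M_n(D)$ with $h(x\alpha,y\beta)=\bar{\alpha}^th(x,y)\beta$ and $h(y,x)=\varepsilon\,\overline{h(x,y)}^t$ for all $x,y\in M$ and $\alpha,\beta\in M_n(D)$. *)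

(* Defs.v *)
From mathcomp Require Import all_boot all_order all_algebra all_field.

Set Implicit Arguments.
Unset Strict Implicit.
Unset Printing Implicit Defensive.

Import GRing.Theory.

Local Open Scope ring_scope.

Definition involution (R : pzRingType) (s : R -> R) : Prop :=
  [/\ {morph s : x y / x + y},
      {morph s : x y / x * y >-> y * x} &
      involutive s].

(* [unitRingType] inverses are total, so invertibility of the nonzero elements
   is what has to be required; [1 != 0] is part of [falgType]. *)
Definition division_algebra (K : fieldType) (D : falgType K) : Prop :=
  forall x : D, x != 0 -> x \is a GRing.unit.

Definition central_algebra (K : fieldType) (D : falgType K) : Prop :=
  'Z({:D})%VS = 1%VS.

Definition conj_trmx (D : pzRingType) (s : D -> D) (m n : nat)
  (A : 'M[D]_(m, n)) : 'M[D]_(n, m) := (map_mx s A)^T.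

Definition right_module (R : pzRingType) (M : zmodType) (act : M -> R -> M)
  : Prop :=
  [/\ forall x y a, act (x + y) a = act x a + act y a,
      forall x a b, act x (a + b) = act x a + act x b,
      forall x a b, act x (a * b) = act (act x a) b &
      forall x, act x 1 = x].

Lemma mulmx_right_module (D : pzRingType) (k n : nat) :
  @right_module 'M[D]_n 'M[D]_(k, n) (@mulmx D k n n).
Proof.
split=> [x y a | x a b | x a b | x].
- exact: mulmxDl.
- exact: mulmxDr.
- exact: mulmxA.
- exact: mulmx1.
Qed.

Record eps_hermitian_form (D : pzRingType) (s : D -> D) (eps : D) (n : nat)
    (M : zmodType) (act : M -> 'M[D]_n -> M) (h : M -> M -> 'M[D]_n) : Prop :=
  HermitianForm {
    herm_module : right_module act;
    herm_addl : forall y, {morph h^~ y : x x' / x + x'};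
    herm_addr : forall x, {morph h x : y y' / y + y'};
    herm_sesqui : forall x y (a b : 'M[D]_n),
      h (act x a) (act y b) = conj_trmx s a *m h x y *m b;
    herm_sym : forall x y, h y x = eps *: conj_trmx s (h x y)
  }.

Definition eps_hermitian_mx (D : pzRingType) (s : D -> D) (eps : D) (k : nat)
  (B : 'M[D]_k) : Prop := conj_trmx s B = eps *: B.

(* Main.v *)
Require Import Defs.
From mathcomp Require Import all_boot all_order all_algebra all_field.

Set Implicit Arguments.
Unset Strict Implicit.
Unset Printing Implicit Defensive.

Import GRing.Theory.

Local Open Scope ring_scope.

(** As a right module over the n x n matrices, the space of k x n matrices is
    generated by the k matrix units E_i having their single 1 in row i and in
    one fixed column j0, because x is the sum of the products E_i a_i, where
    a_i is the square matrix carrying row i of x in its row j0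
    ([sum_delta_in_row]).  Sesquilinearity therefore determines h by the
    matrices h(E_i, E_j).  As a_i vanishes outside row j0, the product
    a_i^* h(E_i, E_j) a_j involves only the (j0, j0) entry of h(E_i, E_j): these
    entries form the matrix B ([gram_mx]), and summing over i and j gives
    x^* B y ([herm_gram]).  The symmetry of B is that of h read at the (j0, j0)
    entry ([gram_eps_hermitian]). *)

(** The coefficient a_i of the generator E_i is [in_row j0 (row i x)]. *)
Definition in_row (D : pzRingType) (n : nat) (j0 : 'I_n) (r : 'rV[D]_n) :
    'M[D]_n :=
  \matrix_(p, q) (if p == j0 then r 0 q else 0).

Lemma sum_delta_in_row (D : pzRingType) (k n : nat) (j0 : 'I_n)
    (x : 'M[D]_(k, n)) :
  x = \sum_i delta_mx i j0 *m in_row j0 (row i x).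
Proof.
apply/matrixP=> p q; rewrite summxE (bigD1 p) //= big1 => [|i ne_ip].
  rewrite addr0 mxE (bigD1 j0) //= big1 => [|u ne_u].
    by rewrite !mxE !eqxx mul1r addr0.
  by rewrite !mxE (negPf ne_u) mulr0.
by rewrite mxE big1 // => u _; rewrite !mxE eq_sym (negPf ne_ip) mul0r.
Qed.

Lemma additive_map0 (U V : zmodType) (f : U -> V) :
  {morph f : x y / x + y} -> f 0 = 0.
Proof. by move=> fD; apply: (addrI (f 0)); rewrite -fD !addr0. Qed.

Lemma in_row_sandwich (D : pzRingType) (s : D -> D) (s0 : s 0 = 0) (n : nat)
    (j0 : 'I_n) (r t : 'rV[D]_n) (H : 'M[D]_n) (p q : 'I_n) :
  (conj_trmx s (in_row j0 r) *m H *m in_row j0 t) p q =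
    s (r 0 p) * H j0 j0 * t 0 q.
Proof.
rewrite mxE (bigD1 j0) //= big1 => [|v ne_v]; last first.
  by rewrite !mxE (negPf ne_v) mulr0.
rewrite addr0 mxE (bigD1 j0) //= big1 => [|u ne_u]; last first.
  by rewrite !mxE (negPf ne_u) s0 mul0r.
by rewrite !mxE eqxx addr0.
Qed.

Definition gram_mx (D : pzRingType) (k n : nat) (j0 : 'I_n)
    (h : 'M[D]_(k, n) -> 'M[D]_(k, n) -> 'M[D]_n) : 'M[D]_k :=
  \matrix_(i, j) h (delta_mx i j0) (delta_mx j j0) j0 j0.

Lemma herm_gram (D : pzRingType) (s : D -> D) (inv_s : involution s) (eps : D)
    (k n : nat) (j0 : 'I_n) (h : 'M[D]_(k, n) -> 'M[D]_(k, n) -> 'M[D]_n)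
    (herm_h : eps_hermitian_form s eps (@mulmx D k n n) h)
    (x y : 'M[D]_(k, n)) :
  h x y = conj_trmx s x *m gram_mx j0 h *m y.
Proof.
have [sD _ _] := inv_s; have s0 := additive_map0 sD.
have h_suml z : {morph h^~ z : a b / a + b} := herm_addl herm_h z.
have h_sumr z : {morph h z : a b / a + b} := herm_addr herm_h z.
apply/matrixP=> p q.
rewrite {1}(sum_delta_in_row j0 y).
rewrite (big_morph _ (h_sumr x) (additive_map0 (h_sumr x))) summxE mxE.
apply: eq_bigr => j _; rewrite {1}(sum_delta_in_row j0 x).
rewrite (big_morph (h^~ _) (h_suml _) (additive_map0 (h_suml _))) summxE.
rewrite mxE mulr_suml; apply: eq_bigr => i _.
by rewrite (herm_sesqui herm_h) (in_row_sandwich s0) !mxE.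
Qed.

(** The symmetry of h expresses h(y, x) through h(x, y), whereas that of a
    matrix expresses its conjugate transpose through itself; the two agree
    because eps is its own inverse. *)
Lemma gram_eps_hermitian (D : pzRingType) (s : D -> D) (eps : D)
    (eps_sq : eps * eps = 1) (k n : nat) (j0 : 'I_n)
    (h : 'M[D]_(k, n) -> 'M[D]_(k, n) -> 'M[D]_n)
    (herm_h : eps_hermitian_form s eps (@mulmx D k n n) h) :
  eps_hermitian_mx s eps (gram_mx j0 h).
Proof.
apply/matrixP=> i j; rewrite !mxE.
by rewrite (herm_sym herm_h (delta_mx j j0)) !mxE mulrA eps_sq mul1r.
Qed.

Theorem proposition3p1 (K : fieldType) (char_K : 2%N \notin [pchar K])
    (D : falgType K) (div_D : division_algebra D) (central_D : central_algebra D)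
    (s : D -> D) (inv_s : involution s)
    (n k : nat) (n_ge1 : (1 <= n)%N) (k_ge1 : (1 <= k)%N)
    (eps : D) (eps_sign : eps = 1 \/ eps = -1)
    (h : 'M[D]_(k, n) -> 'M[D]_(k, n) -> 'M[D]_n)
    (herm_h : eps_hermitian_form s eps (@mulmx D k n n) h) :
  exists B : 'M[D]_k,
    eps_hermitian_mx s eps B /\
    forall x y : 'M[D]_(k, n), h x y = conj_trmx s x *m B *m y.
Proof.
have eps_sq : eps * eps = 1 by case: eps_sign => ->; rewrite ?mulrNN mulr1.
pose j0 : 'I_n := Ordinal n_ge1.
exists (gram_mx j0 h); split; first exact: gram_eps_hermitian.
by move=> x y; apply: herm_gram inv_s _ _ _ _ _ herm_h x y.
Qed.
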